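(* Let $H$ be a finitely generated abelian group. Then there exist a group $G$ and a subset $A$ of $G$ such that $|A|=|H:2H|$ and the Takasaki quandle $T(H)$ is isomorphic to $Q(G,A)$. If $H$ is finite, then $G$ can be chosen finite.
   Context: A quandle is a set with a binary operation $*$ such that every map $y\mapsto y*x$ is a bijection, $(x*y)*z=(x*z)*(y*z)$ for all $x,y,z$, and $x*x=x$ for all $x$. The Takasaki quandle $T(H)$ of an abelian group $H$ (written additively) is the set $H$ with operation $x*y=2y-x$. $|H:2H|$ denotes the index of the subgroup $2H=\{2h\mid h\in H\}$ in $H$. For a group $G$ and a subset $A\subseteq G$, the $(G,A)$-quandle $Q(G,A)$ is the quotient of the set $A\times G$ by the equivalence relation $(a,gh)\sim(a,h)$ for $a\in A$, $h\in G$, $g\in C_G(a)=\{x\in G\mid xa=ax\}$, with the (well-defined) quandle operation $[(a,u)]*[(b,v)]=[(a,uv^{-1}bv)]$. *)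

(* Defs.v *)
From HB Require Import structures.
From mathcomp Require Import all_boot all_order all_algebra.
From mathcomp Require Import boolp classical_sets functions cardinality.

Set Implicit Arguments.
Unset Strict Implicit.
Unset Printing Implicit Defensive.

Import GRing.Theory.

Local Open Scope quotient_scope.
Local Open Scope classical_set_scope.

HB.mixin Record isQuandle Q := {
  qop : Q -> Q -> Q;
  qop_bij : forall x, bijective (fun y => qop y x);
  qopD : forall x y z, qop (qop x y) z = qop (qop x z) (qop y z);
  qopxx : forall x, qop x x = x
}.

#[short(type="quandleType")]
HB.structure Definition Quandle := { Q of isQuandle Q }.

Definition quandle_isomorphic (Q Q' : quandleType) : Prop :=
  exists f : Q -> Q', bijective f /\ {morph f : x y / qop x y >-> qop x y}.

Section AbelianGroups.
Local Open Scope ring_scope.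
Variable H : zmodType.
Implicit Types x y z : H.

Definition finitely_generated : Prop :=
  exists (n : nat) (s : n.-tuple H), forall h : H, inIntSpan s h.

Definition double_subgroup : set H := [set k *+ 2 | k in [set: H]].

Definition double_cosets : set (set H) :=
  [set [set h + k | k in double_subgroup] | h in [set: H]].

(* An alias of H, since the Takasaki operation must not become the canonical
   quandle structure of every abelian group. *)
Definition takasaki : Type := H.

Definition takasaki_op x y : H := y *+ 2 - x.

Lemma takasaki_bij x : bijective (fun y => takasaki_op y x).
Proof. by exists (fun y => takasaki_op y x) => y; rewrite /takasaki_op subKr. Qed.

Lemma takasakiD x y z :
  takasaki_op (takasaki_op x y) z =
  takasaki_op (takasaki_op x z) (takasaki_op y z).
Proof.
rewrite /takasaki_op mulrnBl; move: (z *+ 2) (y *+ 2) => a b.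
rewrite mulr2n !opprB -!addrA; congr (_ + _).
by rewrite addrC -!addrA addNr addr0 addrC.
Qed.

Lemma takasakixx x : takasaki_op x x = x.
Proof. by rewrite /takasaki_op mulr2n addrK. Qed.

HB.instance Definition _ :=
  @isQuandle.Build takasaki takasaki_op takasaki_bij takasakiD takasakixx.
End AbelianGroups.
Arguments double_subgroup : clear implicits.
Arguments double_cosets : clear implicits.

Section GroupQuandle.
Local Open Scope group_scope.
Variables (G : groupType) (A : set G).

(* The pairs (a, u) and (b, v) are related when a = b and u = g v for some g in
   the centralizer of a; A is coerced to the type of its elements. *)
Definition ga_rel : rel (A * G) := fun p q =>
  `[< p.1 = q.1 /\ exists2 g : G, commute g (val p.1) & p.2 = g * q.2 >].

Lemma ga_rel_refl : reflexive ga_rel.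
Proof.
move=> p; apply/asboolP; split=> //; exists 1; last by rewrite mul1g.
by apply/commute_sym/commute1.
Qed.

Lemma ga_rel_sym : symmetric ga_rel.
Proof.
move=> p q; apply/asboolP/asboolP => -[e [g cg eg]]; split=> //; exists g^-1.
- by apply/commute_sym/commuteV/commute_sym; rewrite -e.
- by rewrite eg mulKg.
- by apply/commute_sym/commuteV/commute_sym; rewrite -e.
- by rewrite eg mulKg.
Qed.

Lemma ga_rel_trans : transitive ga_rel.
Proof.
move=> q p r /asboolP[e [g cg eg]] /asboolP[e' [h ch eh]]; apply/asboolP.
split; first by rewrite e.
exists (g * h); last by rewrite eg eh mulgA.
by apply/commute_sym/commuteM; apply/commute_sym => //; rewrite e.
Qed.

Canonical ga_equiv := EquivRel ga_rel ga_rel_refl ga_rel_sym ga_rel_trans.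

Definition ga_quandle : Type := {eq_quot ga_equiv}.

HB.instance Definition _ := EqQuotient.on ga_quandle.

Definition ga_op0 (p q : A * G) : A * G :=
  (p.1, p.2 * q.2^-1 * val q.1 * q.2).

Definition ga_op : ga_quandle -> ga_quandle -> ga_quandle :=
  lift_op2 ga_quandle ga_op0.

Lemma ga_relP (p q : A * G) :
  reflect (p.1 = q.1 /\ exists2 g : G, commute g (val p.1) & p.2 = g * q.2)
          (\pi_ga_quandle p == \pi_ga_quandle q).
Proof. by rewrite eqmodE; apply: asboolP. Qed.

Lemma ga_opE (p q : A * G) :
  ga_op (\pi_ga_quandle p) (\pi_ga_quandle q) = \pi_ga_quandle (ga_op0 p q).
Proof.
rewrite /ga_op; unlock; apply/eqP/ga_relP.
case: piP => p' /eqP/ga_relP[e [g cg eg]].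
case: piP => q' /eqP/ga_relP[e' [h ch eh]].
rewrite /ga_op0 /=; split=> //; exists g^-1.
  by apply/commute_sym/commuteV/commute_sym; rewrite -e.
rewrite eg eh invgM !mulgA mulVg mul1g; congr (_ * _).
by rewrite -e' -[RHS]mulgA -ch mulgA mulgVK.
Qed.

Lemma ga_op_bij x : bijective (fun y => ga_op y x).
Proof.
pose inv (p q : A * G) : A * G := (p.1, p.2 * q.2^-1 * (val q.1)^-1 * q.2).
elim/quotW: x => q.
exists (fun y => \pi_ga_quandle (inv (repr y) q)); elim/quotW=> p.
  rewrite ga_opE; case: piP => r /esym/eqP/ga_relP[/= e [g cg eg]].
  apply/eqP/ga_relP; split=> //; exists g => //=.
  by rewrite eg !mulgA !(mulgK, mulgVK).
rewrite ga_opE -[RHS]reprK; congr (\pi _).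
by rewrite /ga_op0 /inv /= !(mulgK, mulgVK); case: (repr _).
Qed.

Lemma ga_opD x y z : ga_op (ga_op x y) z = ga_op (ga_op x z) (ga_op y z).
Proof.
elim/quotW: x => p; elim/quotW: y => q; elim/quotW: z => r.
rewrite !ga_opE /ga_op0 /=; congr (\pi_ga_quandle (_, _)).
by rewrite !invgM invgK !mulgA !(mulgK, mulgVK).
Qed.

Lemma ga_opxx x : ga_op x x = x.
Proof.
elim/quotW: x => p; rewrite ga_opE; apply/eqP/ga_relP; split=> //=.
by exists (val p.1); rewrite ?mulgV ?mul1g //= -mulgA mulgV.
Qed.

HB.instance Definition _ :=
  @isQuandle.Build ga_quandle ga_op ga_op_bij ga_opD ga_opxx.
End GroupQuandle.

(* Main.v *)
From HB Require Import structures.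
Require Import Defs.
From mathcomp Require Import all_boot all_order all_algebra.
From mathcomp Require Import boolp classical_sets functions cardinality.

(** In the generalized dihedral group Dih(H), the semidirect product of H by
    Z/2 acting by inversion, the reflections r_x (x in H) satisfy
    r_y^-1 r_x r_y = r_(2y - x), so x |-> r_x embeds T(H) into the conjugation
    quandle of Dih(H); its image is closed under conjugation, and conjugacy
    classes of reflections correspond to cosets of 2H.  On the other hand
    [(a, u)] |-> u^-1 a u maps Q(G, A) onto the union of the conjugacy classes of
    the elements of A, and it is injective as soon as distinct elements of A are
    not conjugate.  So G = Dih(H) and A = one reflection per coset of 2H. *)

Import GRing.Theory.

Local Open Scope classical_set_scope.
Local Open Scope card_scope.

Section ConjugationQuandles.
Local Open Scope group_scope.
Local Open Scope quotient_scope.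

(** For a common first component [a], [a ^ u = a ^ v] means that [u * v^-1] centralizes [a], which
    is the relation being quotiented by; the hypothesis on [A] forces the first components to
    agree. *)
Lemma ga_quandle_piE (G : groupType) (A : set G) (p q : A * G) :
  (forall a b u v, A a -> A b -> a ^ u = b ^ v -> a = b) ->
  \pi_(ga_quandle A) p = \pi_(ga_quandle A) q <->
  val p.1 ^ p.2 = val q.1 ^ q.2.
Proof.
move=> Ainj; split=> [/eqP/ga_relP[e [g cg ->]]|e].
  by rewrite conjgM -e; congr (_ ^ _); apply/conjg_fixP/commgP/commute_sym.
have epq : p.1 = q.1.
  by apply/val_inj/(Ainj _ _ p.2 q.2) => //; apply: set_valP.
apply/eqP/ga_relP; split=> //; exists (p.2 * q.2^-1); last by rewrite mulgVK.
by apply/commute_sym/commgP/conjg_fixP; rewrite conjgM e epq conjgK.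
Qed.

Lemma quandle_isomorphic_ga (Q : quandleType) (G : groupType) (A : set G)
    (e : Q -> G) :
  injective e -> {morph e : x y / qop x y >-> x ^ y} ->
  (forall a b u v, A a -> A b -> a ^ u = b ^ v -> a = b) ->
  range e = [set a ^ u | a in A & u in [set: G]] ->
  quandle_isomorphic Q (ga_quandle A).
Proof.
move=> einj eM Ainj eA.
have exP x : exists p : A * G, val p.1 ^ p.2 = e x.
  have /[!eA] -[a Aa [u _ <-]] : range e (e x) by exists x.
  by exists (SigSub (mem_set Aa), u).
(* Any choice of pair will do: its class depends only on the conjugate [e x]. *)
pose f x := sval (cid (exP x)).
have fE x : val (f x).1 ^ (f x).2 = e x by rewrite /f; case: cid.
exists (fun x => \pi_(ga_quandle A) (f x)); split; last first.
  move=> x y; rewrite [RHS]ga_opE; apply/ga_quandle_piE => //.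
  (* Both sides come down to [a ^ (u * v^-1 * b * v) = (a ^ u) ^ (b ^ v)]. *)
  by rewrite fE eM -!fE /ga_op0 /= !conjgE !invgM invgK !mulgA.
rewrite -setTT_bijective; split=> // [x y _ _ /ga_quandle_piE - /(_ Ainj)|].
  by rewrite !fE => /einj.
move=> z _; elim/quotW: z => p.
have [x _ ex] : range e (val p.1 ^ p.2).
  by rewrite eA; exists (val p.1); [apply: set_valP | exists p.2].
by exists x => //; apply/ga_quandle_piE => //; rewrite fE.
Qed.

End ConjugationQuandles.

Section Dihedral.
Local Open Scope ring_scope.
Variable H : zmodType.
Implicit Types x y h k : H.

(* (x, b) stands for the map h |-> x + (-1)^b h of H. *)
Definition dihedral : Type := H * bool.
HB.instance Definition _ := Choice.on dihedral.

Definition dihedral_mul (p q : dihedral) : dihedral :=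
  (p.1 + (if p.2 then - q.1 else q.1), p.2 (+) q.2).

(** Elements [(x, true)] are involutions; only translations change sign. *)
Definition dihedral_inv (p : dihedral) : dihedral :=
  (if p.2 then p.1 else - p.1, p.2).

Lemma dihedral_mulA : associative dihedral_mul.
Proof.
move=> [x []] [y []] [z []]; rewrite /dihedral_mul /=;
  by rewrite ?opprD ?opprK ?addrA.
Qed.

Lemma dihedral_mul1 : left_id ((0, false) : dihedral) dihedral_mul.
Proof. by case=> x b; rewrite /dihedral_mul /= add0r. Qed.

Lemma dihedral_mulr1 : right_id ((0, false) : dihedral) dihedral_mul.
Proof. by case=> x []; rewrite /dihedral_mul /= ?oppr0 addr0. Qed.

Lemma dihedral_mulV :
  left_inverse ((0, false) : dihedral) dihedral_inv dihedral_mul.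
Proof.
by case=> x []; rewrite /dihedral_mul /dihedral_inv /= ?subrr ?addNr.
Qed.

Lemma dihedral_mulrV :
  right_inverse ((0, false) : dihedral) dihedral_inv dihedral_mul.
Proof.
by case=> x []; rewrite /dihedral_mul /dihedral_inv /= subrr.
Qed.

HB.instance Definition _ :=
  isMonoid.Build dihedral dihedral_mulA dihedral_mul1 dihedral_mulr1.
HB.instance Definition _ := hasInv.Build dihedral dihedral_inv.
HB.instance Definition _ :=
  Monoid_isGroup.Build dihedral dihedral_mulV dihedral_mulrV.

Definition reflection x : dihedral := (x, true).

Lemma reflection_inj : injective reflection.
Proof. by move=> x y []. Qed.

Lemma reflectionJ x (u : dihedral) :
  (reflection x ^ u)%g = reflection (if u.2 then u.1 *+ 2 - x else x - u.1 *+ 2).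
Proof.
rewrite conjgE /mul /inv /= /dihedral_mul /dihedral_inv /reflection.
by case: u => u [] /=; congr (_, _); rewrite mulr2n ?opprB ?opprD addrCA ?addrA.
Qed.

Definition double_coset h : set H := [set h + k | k in double_subgroup H].

Lemma double_coset_refl h : double_coset h h.
Proof. by exists 0; [exists 0; rewrite ?mul0rn | rewrite addr0]. Qed.

Lemma double_cosetP x y :
  double_coset x y <-> double_coset x = double_coset y.
Proof.
split=> [[_ [k _ <-] <-]|->]; last exact: double_coset_refl.
apply/seteqP; split=> _ [_ [l _ <-] <-].
  exists ((l - k) *+ 2); first by exists (l - k).
  by rewrite mulrnBl addrA addrAC addrK addrC.
exists ((k + l) *+ 2); first by exists (k + l).
by rewrite mulrnDl addrA.
Qed.

(** Conjugation by a translation shifts [x] by an element of 2H, and conjugation by a reflection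
    gives 2h - x = x + 2(h - x), so neither leaves the coset of [x]. *)
Lemma reflectionJ_coset x y (u v : dihedral) :
  (reflection x ^ u)%g = (reflection y ^ v)%g -> double_coset x = double_coset y.
Proof.
have coset z w : exists2 t, (reflection z ^ w)%g = reflection t
    & double_coset z = double_coset t.
  rewrite reflectionJ; eexists => //; apply/double_cosetP.
  case: w => w [] /=.
    by exists ((w - z) *+ 2); [exists (w - z) |
      rewrite mulrnBl mulr2n addrCA opprD [z + _]addrA subrr add0r].
  by exists ((- w) *+ 2); [exists (- w) | rewrite mulNrn].
by have [s -> ->] := coset x u; have [t -> ->] := coset y v => /reflection_inj ->.
Qed.

Definition reflection_transversal : set dihedral :=
  [set reflection (xget 0 C) | C in double_cosets H].

Lemma double_coset_xget C : double_cosets H C -> double_coset (xget 0 C) = C.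
Proof.
case=> h _ <-; apply/esym/double_cosetP.
exact: xgetI (double_coset_refl h).
Qed.

(** A coset is recovered from its chosen element, so distinct cosets yield distinct reflections. *)
Lemma card_reflection_transversal :
  reflection_transversal #= double_cosets H.
Proof.
apply: inj_card_eq => C D /set_mem hC /set_mem hD /reflection_inj e.
by rewrite -(double_coset_xget _ hC) e double_coset_xget.
Qed.

Lemma takasaki_isomorphic_ga :
  quandle_isomorphic (takasaki H) (ga_quandle reflection_transversal).
Proof.
apply: (@quandle_isomorphic_ga _ _ _ (reflection : takasaki H -> dihedral)).
- exact: reflection_inj.
- by move=> x y; rewrite reflectionJ.
- move=> _ _ u v [C hC <-] [D hD <-] /reflectionJ_coset.
  by rewrite !double_coset_xget // => ->.
- apply/seteqP; split=> [_ [x _ <-]|_ [_ [C _ <-] [u _ <-]]]; last first.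
    by rewrite reflectionJ; eexists.
  have hC : double_cosets H (double_coset x) by exists x.
  exists (reflection (xget 0 (double_coset x))); first by exists (double_coset x).
  have : double_coset (xget 0 (double_coset x)) x.
    by apply/double_cosetP; rewrite double_coset_xget.
  (* With c the chosen element and x = c + 2k, conjugating by the translation by -k takes the
     reflection at c to the one at c - 2(-k) = x. *)
  case=> _ [k _ <-] e; exists (- k, false) => //.
  by rewrite reflectionJ /= mulNrn opprK e.
Qed.

Lemma finite_dihedral : finite_set [set: H] -> finite_set [set: dihedral].
Proof.
by move=> finH; rewrite -[X in finite_set X]setXTT; apply: finite_setX.
Qed.

End Dihedral.

Theorem theorem6p5 (H : zmodType) (Hfg : finitely_generated H) :
  (exists (G : groupType) (A : set G),
     A #= double_cosets H /\
     quandle_isomorphic (takasaki H) (ga_quandle A)) /\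
  (finite_set [set: H] ->
   exists (G : groupType) (A : set G),
     [/\ finite_set [set: G],
         A #= double_cosets H &
         quandle_isomorphic (takasaki H) (ga_quandle A)]).
Proof.
have cardA := card_reflection_transversal H.
have isoA := takasaki_isomorphic_ga H.
(* The same pair serves both claims: as a set, the group is H × [bool]. *)
split=> [|/finite_dihedral finG].
  by exists (dihedral H), (reflection_transversal H).
by exists (dihedral H), (reflection_transversal H).
Qed.
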